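(* Let $I=(a,b)$ be a finite interval and let $g$ be completely monotone on $I$. Then $g$ can be extended analytically into the complex $z$-plane ($z=x+iy$) so that the extended function $g(z)$ is analytic in the disc $|z-b|<b-a$ and is completely monotone in $(a,b]$. If $I=(-\infty,b)$ with $b$ finite and $g$ is completely monotone on $I$, then $g$ extends to a function $g(z)$ analytic in the whole plane. If $I=(a,\infty)$ with $a$ finite and $g$ is completely monotone on $I$, then $g$ extends to a function $g(z)$ analytic in the half-plane $\mathrm{Re}\,z>a$. If $I=(-\infty,\infty)$ and $g$ is completely monotone on $I$, then $g$ extends to a function $g(z)$ analytic in the whole plane.
   Context: A function $g:I\to\mathbb{R}$ on an interval $I\subseteq\mathbb{R}$ is called completely monotone if it has derivatives of all orders and $(-1)^n g^{(n)}(x)\ge 0$ for all $n=0,1,2,\ldots$ and all $x\in I$. *)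

(* Defs.v *)
(* Reals and complex numbers are those of Stdlib and Coquelicot. *)
From Stdlib Require Import Reals.
From Coquelicot Require Import Coquelicot.

Open Scope R_scope.

(* Derivative relative to a set: two-sided at interior points of [I],
   one-sided at an endpoint belonging to [I]. *)
Definition is_derive_in (I : R -> Prop) (f : R -> R) (x l : R) : Prop :=
  filterlim (fun y => (f y - f x) / (y - x)) (within I (locally' x)) (locally l).

(* [d n] is the n-th derivative of [g] on [I]; it is unique there whenever [I]
   is an interval with more than one point. *)
Definition completely_monotone (I : R -> Prop) (g : R -> R) : Prop :=
  exists d : nat -> R -> R,
    (forall x, I x -> d 0%nat x = g x) /\
    (forall n x, I x -> is_derive_in I (d n) x (d (S n) x)) /\
    (forall n x, I x -> 0 <= (-1) ^ n * d n x).

(* Local expansion in a convergent power series at every point of [U];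
   [U] is meant to be open. *)
Definition analytic_on (U : C -> Prop) (f : C -> C) : Prop :=
  forall z0, U z0 ->
    exists c : nat -> C,
      locally z0 (fun z =>
        is_pseries (K := C_AbsRing) (V := C_NormedModule) c (z - z0)%C (f z)).

Definition extends (G : C -> C) (I : R -> Prop) (g : R -> R) : Prop :=
  forall x, I x -> G (RtoC x) = RtoC (g x).

(* A complex function is completely monotone on a real interval when it is
   real-valued there and that real function is completely monotone. *)
Definition completely_monotone_C (I : R -> Prop) (G : C -> C) : Prop :=
  exists h : R -> R, extends G I h /\ completely_monotone I h.

(* Main.v *)
(* Write [f_n = (-1)^n g^(n)], so [f_n >= 0] and [f_n' = - f_(n+1)]. In the
   Taylor polynomial of [g] at [x] about a variable centre [t >= x],
     [F_n(t, x) = sum_(k <= n) f_k(t) (t - x)^k / k!],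
   every term is nonnegative and [dF_n/dt = - f_(n+1)(t) (t - x)^n / n! <= 0].
   Comparing [x] with some [x' < x] shows that the remainder [g(x) - F_n(c, x)]
   is at most [((c - x) / (c - x'))^n g(x')] (Bernstein), and this survives when
   [c] tends to a right endpoint, where the [f_k] have limits by monotonicity.
   Hence [g] is the sum on [(a, c)] of its Taylor series at [c], which converges
   in the complex disc [|z - c| < c - a]. For unbounded intervals these discs
   are nested and, by re-expansion, the series agree on the smaller disc. *)
Require Import Defs.
From Stdlib Require Import Reals Lra Lia Factorial.
From Coquelicot Require Import Coquelicot.
Open Scope R_scope.

(** * Relative derivatives and the sign-adjusted family of derivatives *)

Lemma is_derive_in_open (I : R -> Prop) (f : R -> R) (x l : R) :
  locally x I -> is_derive_in I f x l -> is_derive f x l.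
Proof.
  intros HI Hf. apply is_derive_Reals. intros eps Heps.
  assert (HP : within I (locally' x)
    (fun y => Rabs ((f y - f x) / (y - x) - l) < eps)).
  { apply (Hf (fun q => Rabs (q - l) < eps)).
    exists (mkposreal eps Heps). intros y Hy. exact Hy. }
  destruct (filter_and _ _ HI HP) as [d Hd].
  exists d. intros h Hh Hhd.
  destruct (Hd (x + h)) as [H1 H2].
  { change (Rabs (x + h - x) < d). now replace (x + h - x) with h by ring. }
  specialize (H2 ltac:(lra) H1). cbv beta in H2.
  now replace (x + h - x) with h in H2 by ring.
Qed.

Lemma is_derive_is_derive_in (I : R -> Prop) (f : R -> R) (x l : R) :
  is_derive f x l -> is_derive_in I f x l.
Proof.
  intros Hf. apply is_derive_Reals in Hf.
  apply filterlim_locally. intros eps.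
  destruct (Hf eps (cond_pos eps)) as [d Hd].
  exists d. intros y Hy Hyx _.
  change (Rabs ((f y - f x) / (y - x) - l) < eps).
  specialize (Hd (y - x) (Rminus_eq_contra _ _ Hyx) Hy).
  now rewrite (Rplus_minus x y) in Hd.
Qed.

(* [f n] stands for [(-1)^n] times the [n]-th derivative. *)
Definition cm_family (I : R -> Prop) (f : nat -> R -> R) : Prop :=
  forall n x, I x -> 0 <= f n x /\ is_derive (f n) x (- f (S n) x).

(** Openness of [I] turns relative derivatives into ordinary two-sided ones, so the usual calculus
    applies to [f]. *)
Lemma completely_monotone_family (I : R -> Prop) (g : R -> R) :
  open I -> completely_monotone I g ->
  exists f, cm_family I f /\ forall x, I x -> f 0%nat x = g x.
Proof.
  intros Ho [d [H0 [Hd Hs]]].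
  exists (fun n x => (-1) ^ n * d n x). split.
  - intros n x Hx. split; [now apply Hs|].
    replace (- ((-1) ^ S n * d (S n) x)) with ((-1) ^ n * d (S n) x)
      by (simpl; ring).
    apply is_derive_scal, (is_derive_in_open I); auto.
  - intros x Hx. rewrite H0; auto. simpl; ring.
Qed.

(** * Taylor polynomials as functions of their centre *)

Lemma decreasing_derive (f df : R -> R) (s t : R) :
  s <= t -> (forall x, s <= x <= t -> is_derive f x (df x) /\ df x <= 0) ->
  f t <= f s.
Proof.
  intros Hst H.
  destruct (MVT_gen f s t df) as [c [Hc E]].
  - rewrite Rmin_left, Rmax_right by lra. intros x Hx. apply H; lra.
  - rewrite Rmin_left, Rmax_right by lra. intros x Hx.
    apply continuity_pt_filterlim, (ex_derive_continuous f).
    exists (df x). now apply H.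
  - rewrite Rmin_left, Rmax_right in Hc by lra.
    destruct (H c Hc) as [_ Hd]. nra.
Qed.

Definition taylor (f : nat -> R -> R) (n : nat) (t x : R) : R :=
  sum_f_R0 (fun k => f k t * (t - x) ^ k / INR (fact k)) n.

(** The sum telescopes: differentiating the power in the term of index [S n] cancels the derivative
    of the sum up to [n], and only the piece with the highest derivative survives. *)
Lemma is_derive_taylor (f : nat -> R -> R) (n : nat) (t x : R) :
  (forall k, is_derive (f k) t (- f (S k) t)) ->
  is_derive (fun s => taylor f n s x) t
    (- (f (S n) t * (t - x) ^ n / INR (fact n))).
Proof.
  intros Hf. induction n as [|n IH].
  - apply is_derive_ext with (f 0%nat).
    + intros s. unfold taylor; simpl. field.
    + replace (- (f 1%nat t * (t - x) ^ 0 / INR (fact 0))) with (- f 1%nat t)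
        by (simpl; field).
      apply Hf.
  - unfold taylor in *. simpl sum_f_R0.
    assert (Hn : INR (fact n) <> 0) by apply INR_fact_neq_0.
    assert (Hn' : INR (S n) <> 0) by (apply not_0_INR; lia).
    replace (- (f (S (S n)) t * (t - x) ^ S n / INR (fact (S n)))) with
      (- (f (S n) t * (t - x) ^ n / INR (fact n)) +
       ((- f (S (S n)) t * (t - x) ^ S n + f (S n) t * (INR (S n) * (t - x) ^ n))
        / INR (fact (S n)))).
    + apply (is_derive_plus (V := R_NormedModule)); [exact IH|].
      unfold Rdiv.
      apply is_derive_ext with
        (fun s => / INR (fact (S n)) * (f (S n) s * (s - x) ^ S n)).
      { intros s. apply Rmult_comm. }
      rewrite (Rmult_comm _ (/ INR (fact (S n)))). apply is_derive_scal.
      apply (is_derive_mult (f (S n)) (fun s => (s - x) ^ S n));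
        [apply Hf | | exact Rmult_comm].
      replace (INR (S n) * (t - x) ^ n) with (INR (S n) * 1 * (t - x) ^ n)
        by ring.
      apply (is_derive_pow (fun s => s - x) (S n)).
      auto_derive; auto; ring.
    + rewrite fact_simpl, mult_INR. simpl pow. field. split; auto.
Qed.

Lemma taylor_decreasing (I : R -> Prop) (f : nat -> R -> R) (n : nat)
    (x s t : R) :
  cm_family I f -> (forall y, x <= y <= t -> I y) -> x <= s <= t ->
  taylor f n t x <= taylor f n s x.
Proof.
  intros Hf HI Hs.
  apply (decreasing_derive (fun u => taylor f n u x)
    (fun u => - (f (S n) u * (u - x) ^ n / INR (fact n)))); [lra|].
  intros u Hu. split.
  - apply is_derive_taylor. intros k. apply (Hf k u), HI. lra.
  - apply Ropp_le_cancel; rewrite Ropp_0, Ropp_involutive.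
    apply Rmult_le_pos.
    + apply Rmult_le_pos; [apply (Hf (S n) u), HI; lra | apply pow_le; lra].
    + left. apply Rinv_0_lt_compat, INR_fact_lt_0.
Qed.

Lemma taylor_center (f : nat -> R -> R) (n : nat) (x : R) :
  taylor f n x x = f 0%nat x.
Proof.
  unfold taylor. induction n as [|n IH]; simpl; [field|].
  rewrite IH. replace (x - x) with 0 by ring. rewrite Rmult_0_l.
  unfold Rdiv. ring.
Qed.

Lemma taylor_nonneg (f : nat -> R -> R) (n : nat) (t x : R) :
  (forall k, 0 <= f k t) -> x <= t -> 0 <= taylor f n t x.
Proof.
  intros Hf Hx. apply cond_pos_sum. intros k.
  apply Rmult_le_pos.
  - apply Rmult_le_pos; [apply Hf | apply pow_le; lra].
  - left. apply Rinv_0_lt_compat, INR_fact_lt_0.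
Qed.

(* Since [(s - x) / (s - x')] increases with [s], the remainder at [x] is at
   most [rho ^ n] times the remainder at [x'], which positivity bounds by
   [f 0 x']. *)
Lemma taylor_remainder (I : R -> Prop) (f : nat -> R -> R) (n : nat)
    (x' x t c : R) :
  cm_family I f -> (forall y, x' <= y <= t -> I y) -> x' < x -> x <= t <= c ->
  f 0%nat x - ((c - x) / (c - x')) ^ n * f 0%nat x' <= taylor f n t x.
Proof.
  intros Hf HI Hx Ht. set (rho := (c - x) / (c - x')).
  assert (Hrho : 0 <= rho).
  { apply Rmult_le_pos; [lra|]. left. apply Rinv_0_lt_compat. lra. }
  assert (HD : rho ^ n * taylor f n t x' - taylor f n t x
               <= rho ^ n * taylor f n x x' - taylor f n x x).
  { apply (decreasing_derive
      (fun u => rho ^ n * taylor f n u x' - taylor f n u x)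
      (fun u => rho ^ n * (- (f (S n) u * (u - x') ^ n / INR (fact n))) -
                - (f (S n) u * (u - x) ^ n / INR (fact n)))); [lra|].
    intros u Hu.
    assert (Hd : forall k, is_derive (f k) u (- f (S k) u)).
    { intros k. apply (Hf k u), HI. lra. }
    split.
    - apply (is_derive_minus (V := R_NormedModule)).
      + apply is_derive_scal. now apply is_derive_taylor.
      + now apply is_derive_taylor.
    - assert (Hp : (u - x) ^ n <= rho ^ n * (u - x') ^ n).
      { rewrite <- Rpow_mult_distr. apply pow_incr. split; [lra|].
        apply Rmult_le_reg_r with (c - x'); [lra|].
        unfold rho. replace ((c - x) / (c - x') * (u - x') * (c - x'))
          with ((c - x) * (u - x')) by (field; lra).
        nra. }
      assert (Hq : 0 <= f (S n) u * / INR (fact n)).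
      { apply Rmult_le_pos; [apply (Hf (S n) u), HI; lra|].
        left. apply Rinv_0_lt_compat, INR_fact_lt_0. }
      unfold Rdiv. nra. }
  rewrite taylor_center in HD.
  assert (H1 : taylor f n x x' <= taylor f n x' x').
  { apply taylor_decreasing with I; auto; [|lra]. intros y Hy. apply HI. lra. }
  rewrite taylor_center in H1.
  assert (H2 : 0 <= taylor f n t x').
  { apply taylor_nonneg; [|lra]. intros k. apply (Hf k t), HI. lra. }
  assert (H3 : 0 <= rho ^ n) by now apply pow_le.
  nra.
Qed.

(** * Taylor series at a right endpoint *)

(* [A k] are the boundary values at [c]; a constant sequence [u] covers the
   case of an interior point. *)
Definition boundary_values (f : nat -> R -> R) (a c : R) (I : R -> Prop)
    (A : nat -> R) : Prop :=
  exists u : nat -> R,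
    (forall n y, a < y <= u n -> I y) /\ (forall n, a < u n <= c) /\
    is_lim_seq u c /\ forall k, is_lim_seq (fun n => f k (u n)) (A k).

Lemma boundary_values_nonneg I f a c A :
  cm_family I f -> boundary_values f a c I A -> forall k, 0 <= A k.
Proof.
  intros Hf (u & HI & Hu & _ & HA) k.
  apply (is_lim_seq_le (fun _ => 0) (fun n => f k (u n)) 0 (A k));
    [| apply is_lim_seq_const | apply HA].
  intros n. apply Hf, (HI n). specialize (Hu n). lra.
Qed.

Lemma is_lim_seq_pow (u : nat -> R) (l : R) (k : nat) :
  is_lim_seq u l -> is_lim_seq (fun n => u n ^ k) (l ^ k).
Proof.
  intros Hu. induction k as [|k IH]; simpl; [apply is_lim_seq_const|].
  now apply (is_lim_seq_mult' u (fun n => u n ^ k)).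
Qed.

(** Each partial sum of the series at [c] is a limit of Taylor polynomials with centres inside [I],
    so bounds on the latter pass to the limit. *)
Lemma boundary_values_taylor I f a c A n x :
  boundary_values f a c I A ->
  exists u, (forall n y, a < y <= u n -> I y) /\ (forall n, a < u n <= c) /\
    is_lim_seq u c /\
    is_lim_seq (fun m => taylor f n (u m) x)
      (sum_f_R0 (fun k => A k * (c - x) ^ k / INR (fact k)) n).
Proof.
  intros (u & HI & Hu & Hl & HA). exists u. repeat split; auto; try apply Hu.
  assert (Hk : forall k, is_lim_seq
    (fun m => f k (u m) * (u m - x) ^ k / INR (fact k))
    (A k * (c - x) ^ k / INR (fact k))).
  { intros k. apply is_lim_seq_mult'; [|apply is_lim_seq_const].
    apply is_lim_seq_mult'; [apply HA|]. apply is_lim_seq_pow.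
    apply is_lim_seq_minus'; [exact Hl | apply is_lim_seq_const]. }
  unfold taylor. induction n as [|n IH]; simpl; [apply Hk|].
  apply is_lim_seq_plus'; [exact IH | apply Hk].
Qed.

(** A squeeze: the partial sums lie between [f 0 x - rho ^ n * f 0 x'] and [f 0 x], with
    [rho < 1]. *)
Lemma boundary_taylor_series I f a c A x :
  cm_family I f -> boundary_values f a c I A -> a < x < c ->
  is_series (fun k => A k * (c - x) ^ k / INR (fact k)) (f 0%nat x).
Proof.
  (* The midpoint serves as a comparison point strictly between [a] and [x], which forces
     [rho < 1]. *)
  intros Hf HA Hx. set (x' := (a + x) / 2). set (rho := (c - x) / (c - x')).
  assert (Hrho : 0 <= rho < 1).
  { unfold rho, x'. split.
    - apply Rmult_le_pos; [lra|]. left. apply Rinv_0_lt_compat. lra.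
    - apply Rmult_lt_reg_r with (c - (a + x) / 2); [lra|].
      unfold Rdiv at 1. rewrite Rmult_assoc, Rinv_l; lra. }
  assert (HB : forall n, f 0%nat x - rho ^ n * f 0%nat x' <=
    sum_f_R0 (fun k => A k * (c - x) ^ k / INR (fact k)) n <= f 0%nat x).
  { intros n.
    destruct (boundary_values_taylor I f a c A n x HA) as (u & HI & Hu & Hl & HT).
    (* Both bounds need a centre to the right of [x]; since [x < c], the centres [u m] eventually
       are. *)
    assert (He : eventually (fun m => x <= u m)).
    { destruct (proj2 (is_lim_seq_spec _ _) Hl (mkposreal (c - x) ltac:(lra)))
        as [N HN].
      exists N. intros m Hm. specialize (HN m Hm). simpl in HN.
      apply Rabs_lt_between in HN. lra. }
    split.
    - apply (is_lim_seq_le_loc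
        (fun _ => f 0%nat x - rho ^ n * f 0%nat x')
        (fun m => taylor f n (u m) x) (f 0%nat x - rho ^ n * f 0%nat x')
        (sum_f_R0 (fun k => A k * (c - x) ^ k / INR (fact k)) n));
        [|apply is_lim_seq_const | exact HT].
      revert He; apply filter_imp; intros m Hm.
      apply taylor_remainder with I; auto; unfold x' in *; try lra.
      + intros y Hy. apply (HI m). lra.
      + specialize (Hu m). lra.
    - apply (is_lim_seq_le_loc (fun m => taylor f n (u m) x)
        (fun _ => f 0%nat x)
        (sum_f_R0 (fun k => A k * (c - x) ^ k / INR (fact k)) n) (f 0%nat x));
        [|exact HT | apply is_lim_seq_const].
      revert He; apply filter_imp; intros m Hm.
      rewrite <- (taylor_center f n x). apply taylor_decreasing with I; auto.
      + intros y Hy. apply (HI m). lra.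
      + lra. }
  change (is_lim_seq (sum_n (fun k => A k * (c - x) ^ k / INR (fact k)))
    (f 0%nat x)).
  apply (is_lim_seq_ext
    (fun n => sum_f_R0 (fun k => A k * (c - x) ^ k / INR (fact k)) n)).
  { intros n. now rewrite sum_n_Reals. }
  apply is_lim_seq_le_le with
    (u := fun n => f 0%nat x - rho ^ n * f 0%nat x') (w := fun _ => f 0%nat x);
    [exact HB | | apply is_lim_seq_const].
  replace (Finite (f 0%nat x)) with (Finite (f 0%nat x - 0 * f 0%nat x'))
    by (f_equal; ring).
  apply is_lim_seq_minus'; [apply is_lim_seq_const|].
  apply is_lim_seq_mult'; [|apply is_lim_seq_const].
  apply is_lim_seq_geom. rewrite Rabs_pos_eq; lra.
Qed.

(** The sign undoes the one built into [f k], so this is the ordinary coefficient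
    [g^(k)(c) / k!]. *)
Definition taylor_coef (A : nat -> R) (k : nat) : R :=
  (-1) ^ k * A k / INR (fact k).

Lemma is_pseries_taylor_coef I f a c A x :
  cm_family I f -> boundary_values f a c I A -> a < x < c ->
  is_pseries (taylor_coef A) (x - c) (f 0%nat x).
Proof.
  intros Hf HA Hx.
  assert (E : forall k, A k * (c - x) ^ k / INR (fact k) =
    (x - c) ^ k * taylor_coef A k).
  { intros k. replace (c - x) with ((-1) * (x - c)) by ring.
    rewrite Rpow_mult_distr. unfold taylor_coef, Rdiv. ring. }
  apply (is_series_ext (fun k => A k * (c - x) ^ k / INR (fact k))).
  - intros k. now rewrite E, <- pow_n_pow.
  - now apply boundary_taylor_series with I a.
Qed.

(** At the real point [c - s] all terms of the series are nonnegative, so its convergence there is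
    already absolute convergence, on every circle of radius at most [s]. *)
Lemma taylor_coef_summable I f a c A r :
  cm_family I f -> boundary_values f a c I A -> 0 <= r < c - a ->
  ex_series (fun k => Rabs (taylor_coef A k) * r ^ k).
Proof.
  (* The midpoint of [r] and [c - a] is positive even when [r = 0], so [c - s] lies strictly between
     [a] and [c]. *)
  intros Hf HA Hr. set (s := (r + (c - a)) / 2).
  apply (ex_series_le (V := R_CompleteNormedModule) _
    (fun k => A k * (c - (c - s)) ^ k / INR (fact k))).
  - intros k. change norm with Rabs.
    assert (HAk := boundary_values_nonneg _ _ _ _ _ Hf HA k).
    assert (Hfk := INR_fact_lt_0 k).
    replace (Rabs (taylor_coef A k)) with (A k / INR (fact k)).
    + assert (Hq : 0 <= A k / INR (fact k)) by now apply Rdiv_le_0_compat.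
      assert (Hp : 0 <= r ^ k) by now apply pow_le.
      rewrite Rabs_pos_eq by now apply Rmult_le_pos.
      replace (A k * (c - (c - s)) ^ k / INR (fact k))
        with (A k / INR (fact k) * s ^ k).
      * apply Rmult_le_compat_l; [easy|]. apply pow_incr. unfold s. lra.
      * replace (c - (c - s)) with s by ring. field. lra.
    + unfold taylor_coef, Rdiv. rewrite !Rabs_mult, pow_1_abs, Rmult_1_l.
      rewrite Rabs_pos_eq, Rabs_pos_eq; auto.
      left. now apply Rinv_0_lt_compat.
  - exists (f 0%nat (c - s)). apply boundary_taylor_series with I a; auto.
    unfold s. lra.
Qed.

(** * Series of complex numbers *)

Notation is_seriesC := (@is_series C_AbsRing C_NormedModule).

Lemma sum_n_C (u : nat -> C) (N : nat) :
  sum_n (G := C_NormedModule) u N =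
  (sum_n (fun n => Re (u n)) N, sum_n (fun n => Im (u n)) N).
Proof.
  induction N as [|N IH].
  - rewrite !sum_O. now destruct (u 0%nat).
  - now rewrite !sum_Sn, IH.
Qed.

Lemma is_series_C_iff (u : nat -> C) (l : C) :
  is_seriesC u l <->
  is_series (fun n => Re (u n)) (Re l) /\ is_series (fun n => Im (u n)) (Im l).
Proof.
  unfold is_series. split.
  - intros H. split; apply filterlim_locally; intros eps;
      generalize (proj1 (filterlim_locally (U := C_UniformSpace) _ _) H eps);
      apply filter_imp; intros n; rewrite sum_n_C; intros [H1 H2];
      assumption.
  - intros [H1 H2]. apply (filterlim_locally (U := C_UniformSpace)). intros eps.
    generalize (filter_and _ _ (proj1 (filterlim_locally _ _) H1 eps)
      (proj1 (filterlim_locally _ _) H2 eps)).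
    apply filter_imp. intros n [G1 G2]. rewrite sum_n_C. now split.
Qed.

Lemma is_series_C_ext (u v : nat -> C) (l : C) :
  (forall n, u n = v n) -> is_seriesC u l -> is_seriesC v l.
Proof. apply is_series_ext. Qed.

(** Total by the default of [Series]; the value is meaningful only where convergence is
    established. *)
Definition Csum (u : nat -> C) : C :=
  (Series (fun n => Re (u n)), Series (fun n => Im (u n))).

Lemma is_series_Csum (u : nat -> C) :
  ex_series (fun n => Cmod (u n)) -> is_seriesC u (Csum u).
Proof.
  intros H. apply is_series_C_iff.
  split; apply Series_correct;
    apply (ex_series_le (V := R_CompleteNormedModule) _ (fun n => Cmod (u n)));
    auto; intros n; generalize (Rmax_Cmod (u n)); apply Rle_trans;
    [apply Rmax_l | apply Rmax_r].
Qed.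

Lemma Csum_unique (u : nat -> C) (l : C) : is_seriesC u l -> Csum u = l.
Proof.
  intros H. apply is_series_C_iff in H. destruct H as [H1 H2].
  unfold Csum. rewrite (is_series_unique _ _ H1), (is_series_unique _ _ H2).
  now destruct l.
Qed.

(** Past [N] the partial sums of [u] are bounded by the growth of those of [b] since [N], and
    continuity of the norm carries this to the limit. *)
Lemma series_tail_bound (u : nat -> C) (l : C) (b : nat -> R) (B : R) (N : nat) :
  is_seriesC u l -> is_series b B ->
  (forall m, (m <= N)%nat -> u m = 0) -> (forall m, Cmod (u m) <= b m) ->
  Cmod l <= B - sum_n b N.
Proof.
  intros Hu Hb H0 Hle.
  assert (HN : forall n, (n <= N)%nat -> sum_n (G := C_NormedModule) u n = RtoC 0).
  { induction n as [|n IH]; intros Hn.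
    - rewrite sum_O. now apply H0.
    - rewrite sum_Sn, IH, H0 by lia. apply Cplus_0_l. }
  assert (Hp : forall p, Cmod (sum_n (G := C_NormedModule) u (p + N)) <=
    sum_n b (p + N) - sum_n b N).
  { induction p as [|p IH].
    - rewrite HN by lia. rewrite Cmod_0. simpl Nat.add. lra.
    - change (S p + N)%nat with (S (p + N)).
      rewrite !sum_Sn. eapply Rle_trans; [apply Cmod_triangle|].
      specialize (Hle (S (p + N))).
      change (plus (sum_n b (p + N)) (b (S (p + N))))
        with (sum_n b (p + N) + b (S (p + N))). lra. }
  apply (is_lim_seq_le_loc
    (fun M => Cmod (sum_n (G := C_NormedModule) u M))
    (fun M => sum_n b M - sum_n b N) (Cmod l) (B - sum_n b N)).
  - exists N. intros M HM. replace M with ((M - N) + N)%nat by lia. apply Hp.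
  - apply (filterlim_comp _ _ _ _ (norm (V := C_NormedModule)) _ _ _ Hu
      (filterlim_norm l)).
  - apply is_lim_seq_minus'; [exact Hb | apply is_lim_seq_const].
Qed.

(** * Re-expansion of a power series about another centre *)

(* [shift_coef w m k] is the coefficient of [h ^ k] in [(w + h) ^ m]. *)
Fixpoint shift_coef (w : C) (m k : nat) : C :=
  match m with
  | O => match k with O => 1 | S _ => 0 end
  | S m => w * shift_coef w m k +
           match k with O => 0 | S k => shift_coef w m k end
  end%C.

Lemma sum_n_shift {G : AbelianMonoid} (a : nat -> G) (n : nat) :
  sum_n a (S n) = plus (a 0%nat) (sum_n (fun k => a (S k)) n).
Proof.
  unfold sum_n. rewrite sum_Sn_m by lia. f_equal. now rewrite sum_n_m_S.
Qed.

(** Coefficients beyond [m] vanish, so truncation at any [N >= m] is exact; [recenter] relies on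
    this for the low powers. *)
Lemma sum_shift_coef (w h : C) (m N : nat) :
  (m <= N)%nat ->
  sum_n (G := C_Ring) (fun k => shift_coef w m k * h ^ k)%C N = ((w + h) ^ m)%C.
Proof.
  revert N. induction m as [|m IH]; intros N HN.
  - induction N as [|N IHN].
    + rewrite sum_O. simpl. ring.
    + rewrite sum_Sn, IHN by lia. change plus with Cplus. simpl. ring.
  - destruct N as [|N]; [lia|].
    (* [v] collects the contribution of the factor [h], which raises the index by one. *)
    set (v := fun k => match k with
      | O => RtoC 0 | S k => (h * (shift_coef w m k * h ^ k))%C end).
    rewrite (sum_n_ext (G := C_Ring) _ (fun k =>
      plus (mult (K := C_Ring) w (shift_coef w m k * h ^ k)%C) (v k))).
    + rewrite sum_n_plus, sum_n_mult_l, IH by lia.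
      rewrite sum_n_shift. unfold v at 1 2. cbv beta.
      rewrite (sum_n_mult_l (K := C_Ring) h), IH by lia.
      change mult with Cmult; change plus with Cplus. simpl. ring.
    + intros [|k]; change mult with Cmult; change plus with Cplus; simpl; ring.
Qed.

(** The triangle inequality in the recursion replaces [w] by [Cmod w], leaving partial sums of a
    binomial expansion with nonnegative terms. *)
Lemma sum_shift_coef_bound (w : C) (s : R) (m N : nat) :
  0 <= s ->
  sum_n (fun k => Cmod (shift_coef w m k) * s ^ k) N <= (Cmod w + s) ^ m.
Proof.
  intros Hs. assert (Hw := Cmod_ge_0 w).
  revert N. induction m as [|m IH]; intros N.
  - induction N as [|N IHN].
    + rewrite sum_O. simpl. rewrite Cmod_1. lra.
    + rewrite sum_Sn. change plus with Rplus. simpl in *. rewrite Cmod_0. lra.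
  - set (v := fun k => match k with
      | O => 0 | S k => s * (Cmod (shift_coef w m k) * s ^ k) end).
    assert (H1 : sum_n (fun k => Cmod (shift_coef w (S m) k) * s ^ k) N <=
      sum_n (fun k => plus (mult (Cmod w) (Cmod (shift_coef w m k) * s ^ k))
        (v k)) N).
    { rewrite !sum_n_Reals. apply sum_Rle. intros k _.
      change plus with Rplus; change mult with Rmult.
      assert (Hk := pow_le s k Hs).
      apply Rle_trans with ((Cmod w * Cmod (shift_coef w m k) +
        Cmod (match k with O => 0 | S k => shift_coef w m k end)%C) * s ^ k).
      - apply Rmult_le_compat_r; [easy|]. simpl. rewrite <- Cmod_mult.
        apply Cmod_triangle.
      - right. destruct k; simpl; [rewrite Cmod_0|]; ring. }
    assert (H2 : sum_n v N <= s * (Cmod w + s) ^ m).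
    { destruct N as [|N].
      - rewrite sum_O. apply Rmult_le_pos; [easy|]. apply pow_le. lra.
      - rewrite sum_n_shift. unfold v at 1 2. cbv beta.
        rewrite (sum_n_mult_l (K := R_Ring) s).
        change plus with Rplus; change mult with Rmult.
        rewrite Rplus_0_l. now apply Rmult_le_compat_l. }
    rewrite sum_n_plus, (sum_n_mult_l (K := R_Ring) (Cmod w)) in H1.
    change plus with Rplus in H1; change mult with Rmult in H1.
    eapply Rle_trans; [exact H1|]. simpl pow. rewrite Rmult_plus_distr_r.
    apply Rplus_le_compat; [|exact H2]. now apply Rmult_le_compat_l.
Qed.

Lemma shift_coef_bound (w : C) (s : R) (m k : nat) :
  0 <= s -> Cmod (shift_coef w m k) * s ^ k <= (Cmod w + s) ^ m.
Proof.
  intros Hs. eapply Rle_trans; [|apply (sum_shift_coef_bound w s m k Hs)].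
  assert (Hp : forall j, 0 <= Cmod (shift_coef w m j) * s ^ j).
  { intros j. apply Rmult_le_pos; [apply Cmod_ge_0 | now apply pow_le]. }
  destruct k as [|k]; [rewrite sum_O; lra|].
  rewrite sum_Sn, sum_n_Reals. change plus with Rplus.
  assert (H := cond_pos_sum _ k Hp). lra.
Qed.

Lemma pow_n_Cpow (z : C) (n : nat) : pow_n (K := C_Ring) z n = (z ^ n)%C.
Proof. induction n as [|n IH]; simpl; [easy|]. now rewrite IH. Qed.

Lemma Cmod_sum_n (u : nat -> C) (N : nat) :
  Cmod (sum_n (G := C_Ring) u N) <= sum_n (fun k => Cmod (u k)) N.
Proof. apply (norm_sum_n_m (V := C_NormedModule)). Qed.

(** Expanding [(w + h) ^ m] gives a double series whose order of summation is exchanged. Absolute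
    convergence at radius [Cmod w + Cmod h < R0] justifies this through an explicit tail
    estimate. *)
Lemma recenter (a : nat -> C) (R0 : R) (w : C) :
  (forall r, 0 <= r < R0 -> ex_series (fun n => Cmod (a n) * r ^ n)) ->
  Cmod w < R0 ->
  exists c : nat -> C, forall h, Cmod h < R0 - Cmod w ->
    is_pseries (K := C_AbsRing) (V := C_NormedModule) c h
      (Csum (fun n => a n * (w + h) ^ n)%C).
Proof.
  intros Ha Hw. assert (Hw0 := Cmod_ge_0 w).
  set (c := fun k => Csum (fun m => a m * shift_coef w m k)%C).
  assert (Hc : forall k, is_seriesC (fun m => a m * shift_coef w m k)%C (c k)).
  { intros k. apply is_series_Csum. set (s := (R0 - Cmod w) / 2).
    assert (Hs : 0 < s) by (unfold s; lra).
    assert (Hsk := pow_lt s k Hs).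
    apply (ex_series_le (V := R_CompleteNormedModule) _
      (fun n => / s ^ k * (Cmod (a n) * (Cmod w + s) ^ n))).
    - intros n. change norm with Rabs. rewrite Rabs_pos_eq by apply Cmod_ge_0.
      rewrite Cmod_mult. apply Rmult_le_reg_r with (s ^ k); [easy|].
      replace (/ s ^ k * (Cmod (a n) * (Cmod w + s) ^ n) * s ^ k)
        with (Cmod (a n) * (Cmod w + s) ^ n) by (field; lra).
      rewrite Rmult_assoc. apply Rmult_le_compat_l; [apply Cmod_ge_0|].
      apply shift_coef_bound. lra.
    - apply (ex_series_scal (V := R_NormedModule)), Ha. unfold s. lra. }
  exists c. intros h Hh. assert (Hh0 := Cmod_ge_0 h).
  set (b := fun m => Cmod (a m) * (Cmod w + Cmod h) ^ m).
  assert (Hb : ex_series b) by (apply Ha; lra).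
  assert (Hbound : forall m, Cmod ((w + h) ^ m)%C <= (Cmod w + Cmod h) ^ m).
  { intros m. rewrite Cmod_pow. apply pow_incr.
    split; [apply Cmod_ge_0 | apply Cmod_triangle]. }
  assert (HS : is_seriesC (fun n => a n * (w + h) ^ n)%C
    (Csum (fun n => a n * (w + h) ^ n)%C)).
  { apply is_series_Csum.
    apply (ex_series_le (V := R_CompleteNormedModule) _ b); auto.
    intros n. change norm with Rabs. rewrite Rabs_pos_eq by apply Cmod_ge_0.
    rewrite Cmod_mult. apply Rmult_le_compat_l; [apply Cmod_ge_0|]. apply Hbound. }
  set (S := Csum (fun n => a n * (w + h) ^ n)%C) in *.
  set (p := fun N m => sum_n (G := C_Ring) (fun k => shift_coef w m k * h ^ k)%C N).
  (* Only finitely many column sums are added, so they merge into one series over [m] with each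
     power truncated at degree [N]. *)
  assert (Hpart : forall N, is_seriesC (fun m => a m * p N m)%C
    (sum_n (G := C_NormedModule) (fun k => scal (pow_n (K := C_Ring) h k) (c k)) N)).
  { induction N as [|N IH].
    - rewrite sum_O. eapply is_series_C_ext;
        [|apply (is_series_scal (V := C_NormedModule)), Hc].
      intros m. unfold p. rewrite sum_O. change scal with Cmult.
      rewrite pow_n_Cpow. simpl. ring.
    - rewrite sum_Sn. eapply is_series_C_ext;
        [|apply (is_series_plus (V := C_NormedModule));
          [exact IH | apply (is_series_scal (V := C_NormedModule)), Hc]].
      intros m. unfold p. rewrite sum_Sn. change scal with Cmult.
      change plus with Cplus. rewrite pow_n_Cpow. ring. }
  destruct Hb as [B HB].
  (* Terms with [m <= N] cancel. For the others the full and the truncated power are each at most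
     [(Cmod w + Cmod h) ^ m], whence the factor 2 and the tail of a convergent series. *)
  assert (Herr : forall N, Cmod (S - sum_n (G := C_NormedModule)
    (fun k => scal (pow_n (K := C_Ring) h k) (c k)) N)%C
    <= 2 * B - sum_n (fun m => scal 2 (b m)) N).
  { intros N. apply (series_tail_bound
      (fun m => a m * (w + h) ^ m - a m * p N m)%C).
    - apply (is_series_minus (V := C_NormedModule)); auto.
    - now apply (is_series_scal (V := R_NormedModule) 2).
    - intros m Hm. unfold p. rewrite sum_shift_coef by easy. ring.
    - intros m. change (scal 2 (b m)) with (2 * b m).
      replace (a m * (w + h) ^ m - a m * p N m)%C
        with (a m * ((w + h) ^ m + - p N m))%C by ring.
      rewrite Cmod_mult. unfold b.
      replace (2 * (Cmod (a m) * (Cmod w + Cmod h) ^ m)) with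
        (Cmod (a m) * ((Cmod w + Cmod h) ^ m + (Cmod w + Cmod h) ^ m)) by ring.
      apply Rmult_le_compat_l; [apply Cmod_ge_0|].
      eapply Rle_trans; [apply Cmod_triangle|]. rewrite Cmod_opp.
      apply Rplus_le_compat; [apply Hbound|].
      eapply Rle_trans; [apply Cmod_sum_n|].
      rewrite (sum_n_ext _ (fun k => Cmod (shift_coef w m k) * Cmod h ^ k)).
      + now apply sum_shift_coef_bound.
      + intros k. now rewrite Cmod_mult, Cmod_pow. }
  apply (filterlim_locally_ball_norm (U := C_NormedModule)). intros eps.
  generalize (proj1 (filterlim_locally _ _)
    (is_series_scal (V := R_NormedModule) 2 b B HB) eps).
  apply filter_imp. intros N HN.
  change (Rabs (sum_n (fun m => scal 2 (b m)) N - 2 * B) < eps) in HN.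
  apply Rabs_lt_between in HN. specialize (Herr N).
  unfold ball_norm. change norm with Cmod.
  change minus with Cminus.
  rewrite <- Cmod_opp, Copp_minus_distr.
  apply Rle_lt_trans with (1 := Herr). lra.
Qed.

(** * Existence of boundary values *)

Lemma boundary_values_interior (I : R -> Prop) (f : nat -> R -> R) (a c : R) :
  a < c -> (forall y, a < y <= c -> I y) ->
  boundary_values f a c I (fun k => f k c).
Proof.
  intros Hac HI. exists (fun _ => c). repeat split; auto; try lra.
  - apply is_lim_seq_const.
  - intros k. apply is_lim_seq_const.
Qed.

(** Each [f k] is decreasing and bounded below by 0, hence has a limit at [b]. [A] is chosen before
    [a'], so on an interval unbounded to the left one series serves discs of every radius. *)
Lemma boundary_values_endpoint (I : R -> Prop) (f : nat -> R -> R) (a b : R) :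
  cm_family I f -> a < b -> (forall y, a < y < b -> I y) ->
  exists A, forall a', a' <= a -> (forall y, a' < y < b -> I y) ->
    boundary_values f a' b I A.
Proof.
  intros Hf Hab HI.
  (* The shift by 2 keeps [u 0] strictly above [a]; a shift by 1 would give [u 0 = a]. *)
  set (u := fun n => b - (b - a) * / (INR n + 2)).
  assert (Hpos : forall n, 0 < INR n + 2) by (intros n; generalize (pos_INR n); lra).
  assert (Hu : forall n, a < u n < b).
  { intros n. unfold u. specialize (Hpos n).
    assert (H1 : 0 < / (INR n + 2)) by now apply Rinv_0_lt_compat.
    assert (H2 : / (INR n + 2) < 1).
    { rewrite <- Rinv_1. apply Rinv_lt_contravar; [lra|].
      generalize (pos_INR n); lra. }
    nra. }
  assert (Hmon : forall n, u n <= u (S n)).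
  { intros n. unfold u. rewrite S_INR.
    assert (H : / (INR n + 1 + 2) <= / (INR n + 2)).
    { apply Rinv_le_contravar; [apply Hpos | lra]. }
    nra. }
  assert (Hlim : is_lim_seq u b).
  { replace (Finite b) with (Finite (b - (b - a) * 0)) by (f_equal; ring).
    apply is_lim_seq_minus'; [apply is_lim_seq_const|].
    apply is_lim_seq_mult'; [apply is_lim_seq_const|].
    apply (is_lim_seq_inv _ p_infty); [|easy].
    apply (is_lim_seq_plus _ _ p_infty 2 p_infty);
      [apply is_lim_seq_INR | apply is_lim_seq_const | easy]. }
  assert (HA : forall k, ex_finite_lim_seq (fun n => f k (u n))).
  { intros k. apply ex_finite_lim_seq_decr with 0.
    - intros n. apply (decreasing_derive (f k) (fun x => - f (S k) x)); auto.
      intros x Hx.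
      assert (Ix : I x).
      { apply HI. generalize (Hu n) (Hu (S n)). lra. }
      split; [now apply Hf|]. destruct (Hf (S k) x Ix). lra.
    - intros n. apply Hf, HI, Hu. }
  exists (fun k => real (Lim_seq (fun n => f k (u n)))).
  intros a' Ha' HI'. exists u. repeat split; auto.
  - intros n y Hy. apply HI'. specialize (Hu n). lra.
  - specialize (Hu n). lra.
  - specialize (Hu n). lra.
  - intros k. now apply Lim_seq_correct'.
Qed.

(** * Uniqueness of power series coefficients *)

Lemma le_CV_radius (al : nat -> R) (r : R) :
  0 <= r -> is_lim_seq (fun k => al k * r ^ k) 0 -> Rbar_le r (CV_radius al).
Proof.
  intros Hr H. apply Rbar_not_lt_le. intros Hlt.
  apply (CV_disk_outside al r); auto. now rewrite Rabs_pos_eq.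
Qed.

(** Inside the disc of convergence the series may be differentiated term by term, so its
    coefficients are read off from the derivatives at 0. *)
Lemma pseries_coef (al : nat -> R) (F : nat -> R -> R) (e : R) :
  0 < e ->
  (forall k h, Rabs h < e -> is_derive (F k) h (F (S k) h)) ->
  (forall h, Rabs h < e -> is_pseries al h (F 0%nat h)) ->
  forall k, al k = F k 0 / INR (fact k).
Proof.
  intros He HF Hal k.
  assert (HR : Rbar_lt 0 (CV_radius al)).
  { apply Rbar_lt_le_trans with (e / 2); [simpl; lra|].
    apply le_CV_radius; [lra|].
    apply is_lim_seq_ext with
      (fun n => scal (pow_n (K := R_AbsRing) (e / 2) n) (al n)).
    - intros n. rewrite pow_n_pow. apply Rmult_comm.
    - apply ex_series_lim_0. exists (F 0%nat (e / 2)).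
      apply Hal. rewrite Rabs_pos_eq; lra. }
  (* Equality on the whole interval, not only at 0, is what lets the induction differentiate. *)
  assert (HD : forall n h, Rabs h < e -> Derive_n (PSeries al) n h = F n h).
  { induction n as [|n IH]; intros h Hh.
    - simpl. now apply is_pseries_unique, Hal.
    - simpl. rewrite <- (is_derive_unique _ _ _ (HF n h Hh)).
      apply Derive_ext_loc.
      assert (Hd : 0 < e - Rabs h) by lra.
      exists (mkposreal _ Hd). intros y Hy. apply IH.
      change (Rabs (y - h) < e - Rabs h) in Hy.
      replace y with ((y - h) + h) by ring.
      eapply Rle_lt_trans; [apply Rabs_triang | lra]. }
  specialize (HD k 0 ltac:(rewrite Rabs_R0; lra)).
  rewrite Derive_n_coef in HD by easy. rewrite <- HD. field.
  apply INR_fact_neq_0.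
Qed.

(** Splitting into real and imaginary parts reduces the identification of complex coefficients to
    real power series. *)
Lemma is_pseries_C_real (c : nat -> C) (h x : R) :
  is_pseries (K := C_AbsRing) (V := C_NormedModule) c (RtoC h) (RtoC x) ->
  is_pseries (fun k => Re (c k)) h x /\ is_pseries (fun k => Im (c k)) h 0.
Proof.
  intros H. apply is_series_C_iff in H. destruct H as [H1 H2].
  assert (E : forall k, scal (pow_n (K := C_Ring) (RtoC h) k) (c k) =
    (RtoC (h ^ k) * c k)%C).
  { intros k. now rewrite pow_n_Cpow, RtoC_pow. }
  split.
  - eapply is_series_ext; [|exact H1]. intros k. cbv beta.
    etransitivity; [exact (f_equal Re (E k))|]. rewrite re_scal_l.
    now rewrite <- pow_n_pow.
  - eapply is_series_ext; [|exact H2]. intros k. cbv beta.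
    etransitivity; [exact (f_equal Im (E k))|]. rewrite im_scal_l.
    now rewrite <- pow_n_pow.
Qed.

(** * The complex sum of the Taylor series *)

Definition taylor_fun (A : nat -> R) (c : R) (z : C) : C :=
  Csum (fun n => RtoC (taylor_coef A n) * (z - RtoC c) ^ n)%C.

Lemma taylor_fun_real (A : nat -> R) (c x : R) :
  taylor_fun A c (RtoC x) = RtoC (PSeries (taylor_coef A) (x - c)).
Proof.
  unfold taylor_fun, Csum, PSeries, RtoC. f_equal.
  - apply Series_ext. intros n.
    change (Re (RtoC (taylor_coef A n) * (RtoC x - RtoC c) ^ n)%C =
      taylor_coef A n * (x - c) ^ n).
    rewrite <- RtoC_minus, <- RtoC_pow, <- RtoC_mult. apply re_RtoC.
  (* Zero is written as a product so that a factor 0 can be pulled out of the series. *)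
  - rewrite (Series_ext _ (fun _ => 0 * 0)).
    + rewrite Series_scal_l. ring.
    + intros n.
      change (Im (RtoC (taylor_coef A n) * (RtoC x - RtoC c) ^ n)%C = 0 * 0).
      rewrite <- RtoC_minus, <- RtoC_pow, <- RtoC_mult, im_RtoC. ring.
Qed.

Lemma taylor_fun_extends I f a c A x :
  cm_family I f -> boundary_values f a c I A -> a < x < c ->
  taylor_fun A c (RtoC x) = RtoC (f 0%nat x).
Proof.
  intros Hf HA Hx. rewrite taylor_fun_real. f_equal.
  apply is_pseries_unique. now apply is_pseries_taylor_coef with I a.
Qed.

Lemma recenter_taylor_fun I f a c A (z0 : C) :
  cm_family I f -> boundary_values f a c I A ->
  Cmod (z0 - RtoC c)%C < c - a ->
  exists g : nat -> C, forall z,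
    Cmod (z - z0)%C < c - a - Cmod (z0 - RtoC c)%C ->
    is_pseries (K := C_AbsRing) (V := C_NormedModule) g (z - z0)%C
      (taylor_fun A c z).
Proof.
  intros Hf HA Hz0.
  destruct (recenter (fun n => RtoC (taylor_coef A n)) (c - a)
    (z0 - RtoC c)%C) as [g Hg]; auto.
  - intros r Hr. apply ex_series_ext with
      (fun n => Rabs (taylor_coef A n) * r ^ n).
    + intros n. now rewrite Cmod_R.
    + now apply taylor_coef_summable with I f a c.
  - exists g. intros z Hz. specialize (Hg (z - z0)%C Hz).
    unfold taylor_fun. now replace (z - RtoC c)%C
      with (z0 - RtoC c + (z - z0))%C by ring.
Qed.

(** Basic neighbourhoods in [C] are squares; one of half-side [r / sqrt 2] fits in the disc of
    radius [r]. *)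
Lemma locally_Cmod (z0 : C) (r : R) :
  0 < r -> locally z0 (fun z : C => Cmod (z - z0)%C < r).
Proof.
  intros Hr.
  assert (H2 : 0 < sqrt 2) by (apply sqrt_lt_R0; lra).
  assert (He : 0 < r / sqrt 2) by now apply Rdiv_lt_0_compat.
  exists (mkposreal _ He). intros z Hz.
  apply C_NormedModule_mixin_compat2 in Hz. simpl in Hz.
  replace (sqrt 2 * (r / sqrt 2)) with r in Hz by (field; lra). exact Hz.
Qed.

Lemma analytic_on_taylor_fun I f a c A :
  cm_family I f -> boundary_values f a c I A ->
  analytic_on (fun z => Cmod (z - RtoC c)%C < c - a) (taylor_fun A c).
Proof.
  intros Hf HA z0 Hz0.
  destruct (recenter_taylor_fun I f a c A z0 Hf HA Hz0) as [g Hg].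
  exists g.
  generalize (locally_Cmod z0 (c - a - Cmod (z0 - RtoC c)%C) ltac:(lra)).
  apply filter_imp. exact Hg.
Qed.

(* Both series represent [f 0] near [c], so re-expanding the one centred at
   [c'] about [c] gives back the coefficients at [c]. *)
Lemma taylor_fun_consistent I f a c c' z :
  cm_family I f -> (forall y, a < y <= c' -> I y) -> c < c' ->
  Cmod (z - RtoC c)%C < c - a ->
  taylor_fun (fun k => f k c) c z = taylor_fun (fun k => f k c') c' z.
Proof.
  intros Hf HI Hc Hz. assert (Hz0 := Cmod_ge_0 (z - RtoC c)%C).
  assert (HA : boundary_values f a c' I (fun k => f k c'))
    by (apply boundary_values_interior; auto; lra).
  assert (Hcc : Cmod (RtoC c - RtoC c')%C = c' - c).
  { rewrite <- RtoC_minus, Cmod_R, Rabs_minus_sym, Rabs_pos_eq; lra. }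
  destruct (recenter_taylor_fun I f a c' _ (RtoC c) Hf HA) as [g Hg];
    [lra|]. rewrite Hcc in Hg.
  (* For [Rabs h < e] the point [c + h] lies in [(a, c')] and in the disc of radius [c - a] where
     the re-expansion [g] is valid. *)
  set (e := Rmin (c - a) (c' - c)).
  assert (He : 0 < e) by (apply Rmin_pos; lra).
  assert (He1 : e <= c - a) by apply Rmin_l.
  assert (He2 : e <= c' - c) by apply Rmin_r.
  assert (Hreal : forall h, Rabs h < e ->
    is_pseries (fun k => Re (g k)) h (f 0%nat (c + h)) /\
    is_pseries (fun k => Im (g k)) h 0).
  { intros h Hh. apply is_pseries_C_real.
    specialize (Hg (RtoC (c + h))).
    rewrite <- RtoC_minus, Cmod_R in Hg.
    replace (c + h - c) with h in Hg by ring.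
    assert (Hb := Rabs_lt_between h e). apply Hb in Hh as Hh'.
    rewrite (taylor_fun_extends I f a c') in Hg by (auto; lra).
    apply Hg. lra. }
  assert (Hcoef : forall k, g k = RtoC (taylor_coef (fun k => f k c) k)).
  { intros k. apply injective_projections; simpl.
    - change (Re (g k) = taylor_coef (fun k => f k c) k).
      rewrite (pseries_coef (fun k => Re (g k))
        (fun k h => (-1) ^ k * f k (c + h)) e He).
      + unfold taylor_coef. now rewrite Rplus_0_r.
      + intros j h Hh. apply Rabs_lt_between in Hh.
        replace ((-1) ^ S j * f (S j) (c + h))
          with ((-1) ^ j * (1 * - f (S j) (c + h))) by (simpl; ring).
        apply is_derive_scal.
        apply (is_derive_comp (f j) (fun h => c + h)).
        * apply Hf, HI. lra.
        * auto_derive; auto; ring.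
      + intros h Hh. simpl. rewrite Rmult_1_l. now apply Hreal.
    - change (Im (g k) = 0).
      rewrite (pseries_coef (fun k => Im (g k)) (fun _ _ => 0) e He).
      + unfold Rdiv; ring.
      + intros j h _. apply (is_derive_const (V := R_NormedModule) 0 h).
      + intros h Hh. now apply Hreal. }
  apply Csum_unique.
  refine (is_series_C_ext _ _ _ _ (Hg z _)); [|lra].
  intros n. rewrite Hcoef, pow_n_Cpow. apply Cmult_comm.
Qed.

(** * Complete monotonicity up to the endpoint *)

Lemma taylor_coef_CV_radius I f a c A r :
  cm_family I f -> boundary_values f a c I A -> 0 <= r < c - a ->
  Rbar_lt r (CV_radius (taylor_coef A)).
Proof.
  intros Hf HA Hr. set (s := (r + (c - a)) / 2).
  assert (Hs : r < s < c - a) by (unfold s; lra).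
  apply Rbar_lt_le_trans with s; [simpl; lra|].
  apply le_CV_radius; [lra|].
  apply ex_series_lim_0.
  apply (ex_series_le (V := R_CompleteNormedModule) _
    (fun k => Rabs (taylor_coef A k) * s ^ k)).
  - intros k. change norm with Rabs. right.
    rewrite Rabs_mult. f_equal. apply Rabs_pos_eq, pow_le. lra.
  - apply taylor_coef_summable with I f a c; auto. lra.
Qed.

Lemma Series_nonneg (u : nat -> R) :
  (forall n, 0 <= u n) -> ex_series u -> 0 <= Series u.
Proof.
  intros Hu Hex. replace 0 with (Series (fun n => 0 * u n)).
  - apply Series_le; auto. intros n. specialize (Hu n). lra.
  - rewrite Series_scal_l. ring.
Qed.

(** The real series converges in a neighbourhood of each [x] in [(a, b]], including [b], so all its
    derivatives exist there. In powers of [b - x], the series of [(-1) ^ n] times the [n]-th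
    derivative has coefficients [A (k + n) / k!], which are nonnegative. *)
Lemma taylor_fun_completely_monotone I f a b A :
  cm_family I f -> boundary_values f a b I A ->
  completely_monotone_C (fun x => a < x <= b) (taylor_fun A b).
Proof.
  intros Hf HA.
  exists (fun x => PSeries (taylor_coef A) (x - b)). split.
  { intros x _. apply taylor_fun_real. }
  assert (HR : forall x, a < x <= b ->
    Rbar_lt (Rabs (x - b)) (CV_radius (taylor_coef A))).
  { intros x Hx. apply taylor_coef_CV_radius with I f a b; auto.
    rewrite Rabs_minus_sym, Rabs_pos_eq; lra. }
  exists (fun n x => Derive_n (PSeries (taylor_coef A)) n (x - b)).
  split; [easy|split].
  - intros n x Hx. apply is_derive_is_derive_in.
    assert (Hd := is_derive_n_PSeries (S n) _ _ (HR x Hx)).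
    rewrite <- (is_derive_n_unique _ _ _ _ Hd) in Hd.
    rewrite <- (Rmult_1_l (Derive_n _ (S n) _)).
    apply (is_derive_comp (Derive_n (PSeries (taylor_coef A)) n)
      (fun x => x - b)); [exact Hd|].
    auto_derive; auto; ring.
  - intros n x Hx. rewrite Derive_n_PSeries by auto.
    unfold PSeries. rewrite <- Series_scal_l. apply Series_nonneg.
    + intros k. unfold PS_derive_n, taylor_coef.
      replace ((-1) ^ n * (INR (fact (k + n)) / INR (fact k) *
        ((-1) ^ (k + n) * A (k + n)%nat / INR (fact (k + n))) * (x - b) ^ k))
        with (A (k + n)%nat * (b - x) ^ k / INR (fact k)).
      * apply Rdiv_le_0_compat; [|apply INR_fact_lt_0].
        apply Rmult_le_pos; [now apply (boundary_values_nonneg I f a b)|].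
        apply pow_le. lra.
      * replace (b - x) with ((-1) * (x - b)) by ring.
        rewrite Rpow_mult_distr, pow_add.
        assert (H1 : (-1) ^ n * (-1) ^ n = 1).
        { rewrite <- Rpow_mult_distr. replace (-1 * -1) with 1 by ring.
          apply pow1. }
        transitivity (A (k + n)%nat * ((-1) ^ k * ((-1) ^ n * (-1) ^ n) *
          (x - b) ^ k) / INR (fact k)).
        { rewrite H1. field. apply INR_fact_neq_0. }
        field. split; apply INR_fact_neq_0.
    + apply (ex_series_scal (V := R_NormedModule)).
      apply ex_series_ext with (fun k => scal (pow_n (K := R_AbsRing) (x - b) k)
        (PS_derive_n n (taylor_coef A) k)).
      * intros k. rewrite pow_n_pow. apply Rmult_comm.
      * apply (CV_radius_inside (PS_derive_n n (taylor_coef A)) (x - b)).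
        rewrite CV_radius_derive_n. auto.
Qed.

(** * Exhausting a half-plane by discs *)

(* The points of [Re z > a] within distance [c - a] of [c] are those with
   [y^2 < (x - a) (2 c - a - x)]; the union over [c] is the half-plane. *)
Definition half_plane_center (a : R) (z : C) : R :=
  (a + Re z + Im z * Im z / (Re z - a)) / 2 + 1.

(** The disc condition reads [2 c > a + x + y^2 / (x - a)]; the chosen centre satisfies it with 2 to
    spare. *)
Lemma half_plane_center_spec (a : R) (z : C) :
  a < Re z ->
  Cmod (z - RtoC (half_plane_center a z))%C < half_plane_center a z - a.
Proof.
  intros Hz. set (c := half_plane_center a z).
  set (q := Im z * Im z / (Re z - a)).
  assert (Hq : q * (Re z - a) = Im z * Im z) by (unfold q; field; lra).
  assert (Hq0 : 0 <= q).
  { apply Rdiv_le_0_compat; [apply Rle_0_sqr | lra]. }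
  assert (Hc : c = (a + Re z + q) / 2 + 1) by reflexivity.
  assert (Hca : 0 <= c - a) by lra.
  unfold Cmod. rewrite <- (sqrt_pow2 (c - a)) by exact Hca.
  apply sqrt_lt_1_alt.
  change (0 <= (Re z + - c) ^ 2 + (Im z + - 0) ^ 2 < (c - a) ^ 2). split.
  - apply Rplus_le_le_0_compat; apply pow2_ge_0.
  - rewrite Hc. nra.
Qed.

Lemma Re_gt_of_disc (a c : R) (z : C) : Cmod (z - RtoC c)%C < c - a -> a < Re z.
Proof.
  intros H. assert (H1 := Rmax_Cmod (z - RtoC c)%C).
  assert (H2 := Rmax_l (Rabs (fst (z - RtoC c)%C)) (Rabs (snd (z - RtoC c)%C))).
  assert (H3 : Rabs (Re z + - c) < c - a).
  { eapply Rle_lt_trans; [|exact H]. eapply Rle_trans; [exact H2 | exact H1]. }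
  apply Rabs_lt_between in H3. lra.
Qed.

(** * Extensions for the four kinds of interval *)

Theorem corollary2p2 :
  (forall (a b : R) (g : R -> R),
     a < b ->
     completely_monotone (fun x => a < x < b) g ->
     exists G : C -> C,
       extends G (fun x => a < x < b) g /\
       analytic_on (fun z => Cmod (z - RtoC b)%C < b - a) G /\
       completely_monotone_C (fun x => a < x <= b) G) /\
  (forall (b : R) (g : R -> R),
     completely_monotone (fun x => x < b) g ->
     exists G : C -> C,
       extends G (fun x => x < b) g /\
       analytic_on (fun _ => True) G) /\
  (forall (a : R) (g : R -> R),
     completely_monotone (fun x => a < x) g ->
     exists G : C -> C,
       extends G (fun x => a < x) g /\
       analytic_on (fun z => a < Re z) G) /\
  (forall g : R -> R,
     completely_monotone (fun _ => True) g ->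
     exists G : C -> C,
       extends G (fun _ => True) g /\
       analytic_on (fun _ => True) G).
Proof.
  repeat split.
  - intros a b g Hab Hg.
    destruct (completely_monotone_family (fun x => a < x < b) g) as [f [Hf H0]];
      [apply open_and; [apply open_gt | apply open_lt] | exact Hg |].
    destruct (boundary_values_endpoint _ f a b Hf Hab) as [A HA]; [easy|].
    specialize (HA a (Rle_refl a) (fun y Hy => Hy)).
    exists (taylor_fun A b). repeat split.
    + intros x Hx. rewrite <- H0 by easy.
      now apply taylor_fun_extends with (fun x => a < x < b) a.
    + now apply analytic_on_taylor_fun with (fun x => a < x < b) f.
    + now apply taylor_fun_completely_monotone with (fun x => a < x < b) f.
  - intros b g Hg.
    destruct (completely_monotone_family (fun x => x < b) g) as [f [Hf H0]];
      [apply open_lt | exact Hg |].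
    destruct (boundary_values_endpoint _ f (b - 1) b Hf) as [A HA];
      [lra | intros; lra |].
    exists (taylor_fun A b). split.
    + intros x Hx. rewrite <- H0 by easy.
      (* This left end lies below [x] and is at most [b - 1], as the choice of [A] requires. *)
      apply taylor_fun_extends with (fun x => x < b) (Rmin x b - 1); auto.
      * apply HA; [|intros; lra]. generalize (Rmin_r x b). lra.
      * split; [|easy]. generalize (Rmin_l x b). lra.
    + intros z0 _. assert (Hz := Cmod_ge_0 (z0 - RtoC b)%C).
      (* With this left end the disc about [b] has radius [Cmod (z0 - b) + 1] and contains [z0]. *)
      apply (analytic_on_taylor_fun (fun x => x < b) f
        (b - Cmod (z0 - RtoC b)%C - 1) b A Hf); [|lra].
      apply HA; [lra | intros; lra].
  - intros a g Hg.
    destruct (completely_monotone_family (fun x => a < x) g) as [f [Hf H0]];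
      [apply open_gt | exact Hg |].
    set (T := fun c => taylor_fun (fun k => f k c) c).
    assert (HT : forall c c' z, Cmod (z - RtoC c)%C < c - a ->
      Cmod (z - RtoC c')%C < c' - a -> T c z = T c' z).
    { intros c c' z Hc Hc'. destruct (Rtotal_order c c') as [H|[<-|H]]; auto.
      - apply taylor_fun_consistent with (fun x => a < x) a; auto.
        intros y Hy. apply Hy.
      - symmetry. apply taylor_fun_consistent with (fun x => a < x) a; auto.
        intros y Hy. apply Hy. }
    (* The centre varies with [z], but by [HT] any centre whose disc contains [z] gives the same
       value; near a given point one centre can therefore be held fixed. *)
    exists (fun z => T (half_plane_center a z) z). split.
    + intros x Hx. rewrite (HT _ (x + 1)).
      * rewrite <- H0 by easy.
        apply taylor_fun_extends with (fun x => a < x) a; auto; [|lra].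
        apply boundary_values_interior; [lra|]. intros y Hy. apply Hy.
      * apply half_plane_center_spec. exact Hx.
      * rewrite <- RtoC_minus, Cmod_R, Rabs_minus_sym, Rabs_pos_eq; lra.
    + intros z0 Hz0. assert (Hc := half_plane_center_spec a z0 Hz0).
      set (c := half_plane_center a z0) in *.
      assert (Hc0 := Cmod_ge_0 (z0 - RtoC c)%C).
      destruct (recenter_taylor_fun (fun x => a < x) f a c (fun k => f k c) z0 Hf)
        as [s Hs]; auto.
      { apply boundary_values_interior; [lra|]. intros y Hy. apply Hy. }
      exists s.
      generalize (locally_Cmod z0 (c - a - Cmod (z0 - RtoC c)%C) ltac:(lra)).
      apply filter_imp. intros z Hz.
      assert (Hzc : Cmod (z - RtoC c)%C < c - a).
      { replace (z - RtoC c)%C with ((z - z0) + (z0 - RtoC c))%C by ring.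
        eapply Rle_lt_trans; [apply Cmod_triangle | lra]. }
      rewrite (HT _ c); [now apply Hs | | exact Hzc].
      apply half_plane_center_spec. now apply Re_gt_of_disc with c.
  - intros g Hg.
    destruct (completely_monotone_family (fun _ => True) g) as [f [Hf H0]];
      [apply open_true | exact Hg |].
    exists (taylor_fun (fun k => f k 0) 0). split.
    + intros x _. rewrite <- H0 by easy.
      assert (Hx := Rabs_pos x). assert (Hx' := Rle_abs x).
      assert (Hx'' := Rle_abs (- x)). rewrite Rabs_Ropp in Hx''.
      (* The real expansion is available only to the left of its centre, so a possibly positive [x]
         is handled by moving from centre 0 to [c > x]; [a] is low enough for the disc about 0 to
         contain [x]. *)
      set (a := - Rabs x - 1). set (c := Rabs x + 1).
      rewrite (taylor_fun_consistent (fun _ => True) f a 0 c); auto;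
        unfold a, c; try lra.
      * apply taylor_fun_extends with (fun _ => True) a; auto; unfold a; [|lra].
        apply boundary_values_interior; auto. lra.
      * rewrite <- RtoC_minus, Cmod_R, Rminus_0_r. lra.
    + intros z0 _. assert (Hz := Cmod_ge_0 (z0 - RtoC 0)%C).
      apply (analytic_on_taylor_fun (fun _ => True) f
        (- Cmod (z0 - RtoC 0)%C - 1) 0 _ Hf); [|lra].
      apply boundary_values_interior; auto. lra.
Qed.
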